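(* Let $x_j=\dfrac{(-1)^j}{\ln(j+2)}$ for $j\geq 0$. For each arbitrary sequence of real numbers $\{\mu_m\}_{m=0}^\infty$ there is a rearrangement $\{u_j\}_{j=0}^\infty$ of the sequence $\{x_j\}_{j=0}^\infty$ such that $$\sum_{j=0}^\infty u_j^{2m+1}=\mu_m\quad\text{for all } m\geq 0.$$ In particular, there are real sequences $\{u_j\}_{j=0}^\infty$ all of whose odd moments $\sum_{j=0}^\infty u_j^{2m+1}$, $m\ge 0$, vanish but which are not a rearrangement of a symmetrical sequence of order $2$.
   Context: A sequence of complex numbers $\{z_j\}_{j=0}^\infty$ is symmetrical of order $2$ if $\{z_j\}_{j=0}^\infty=\{-z_j\}_{j=0}^\infty$ as sets with repetitions (multisets). A rearrangement of $\{x_j\}_{j=0}^\infty$ is a sequence $\{x_{\sigma(j)}\}_{j=0}^\infty$ with $\sigma$ a bijection of $\{0,1,2,\ldots\}$. Series are sums in the ordinary sense (limits of partial sums in the given order), possibly only conditionally convergent. *)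

(* Defs.v *)
From HB Require Import structures.
From mathcomp Require Import all_boot all_order all_algebra complex.
From mathcomp Require Import all_classical all_reals all_analysis.

Set Implicit Arguments.
Unset Strict Implicit.
Unset Printing Implicit Defensive.

Import GRing.Theory Num.Theory.
Local Open Scope ring_scope.
Local Open Scope complex_scope.
Local Open Scope classical_set_scope.
Local Open Scope card_scope.

Definition rearrangement (T : Type) (x u : nat -> T) : Prop :=
  exists2 sigma : nat -> nat, bijective sigma & forall j, u j = x (sigma j).

(* Multiplicities may be infinite, hence the comparison of cardinalities. *)
Definition same_multiset (T : Type) (z w : nat -> T) : Prop :=
  forall c : T, [set j | z j = c] #= [set j | w j = c].

Definition symmetrical2 (R : realType) (z : nat -> R[i]) : Prop :=
  same_multiset z (fun j => - z j).

Definition xseq (R : realType) (j : nat) : R := (-1) ^+ j / ln (j + 2)%:R.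

(* Main.v *)
Require Import Defs.
From HB Require Import structures.
From mathcomp Require Import all_boot all_order all_algebra complex.
From mathcomp Require Import zify ring lra.
From mathcomp Require Import all_classical all_reals all_analysis.

Set Implicit Arguments.
Unset Strict Implicit.
Unset Printing Implicit Defensive.

Import Order.TTheory GRing.Theory Num.Theory.
Import numFieldNormedType.Exports.
Local Open Scope ring_scope.
Local Open Scope complex_scope.
Local Open Scope classical_set_scope.

(** Write gamma(t) = (t, t^3, t^5, ...), so that the partial sums of all the odd
power series are the partial sums of the vectors gamma (x_j).  A rearrangement
is built in stages, in the spirit of the Levy-Steinitz theorem for conditionally
convergent vector series.  Stage n first uses the term of index n if it is still
unused (so that every index is eventually used), and then brings the first n+1
coordinates of the partial sum to within 1/(n+1) of their targets, using finitely
many unused terms, along an almost straight segment.  Straightness is what gives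
convergence: from the stage where a coordinate m is under control, its distance
to mu m stays during stage n below its initial value, which is at most 1/n, plus
|x_n|^(2m+1) + 1/(n+1), and all of this tends to 0.  This is [next_stage].

The heart is [steering]: terms of arbitrarily large index can move the first d
coordinates by any given vector v along the segment theta * v, up to eps.  By the
Vandermonde determinant the vectors gamma (t_i), truncated to d coordinates, form
a basis for distinct t_i > 0 ([odd_power_basis]), so v is a combination
sum_i c_i gamma (t_i); since gamma is odd, a negative c_i amounts to terms near
- t_i.  For t_i = 1 / ln (2^(p(i+1))) the coefficients grow only polynomially in
p, whereas the terms +-1 / ln (2^(p(i+1)) + k) lie within k / 2^p of +-t_i
([inv_ln_near]).  For large p there are thus enough distinct terms of each sign
close to each t_i to replace every copy of gamma (+-t_i) by the value at a term of
the sequence, with negligible total error.  Taking |c_i| copies of the i-th kind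
in a balanced order ([balanced_word]) keeps the partial sums near the segment:
the numbers of copies deviate from proportionality by a bounded amount, and each
unit of deviation costs at most t_i, which is small.

For the last assertion take all targets equal to 0.  The values of a sequence
symmetrical of order 2 are closed under negation, but no x_k equals
- x_0 = - 1 / ln 2. *)

(** * Balanced words *)

(** Each letter of a word is paired with the number of its earlier occurrences:
when a letter names a supply of terms, the pair says which of them to use. *)
Definition occurrences (I : eqType) (f : seq I) : seq (I * nat) :=
  foldl (fun s i => rcons s (i, count_mem i (unzip1 s))) [::] f.

Lemma unzip1_occurrences (I : eqType) (f : seq I) : unzip1 (occurrences f) = f.
Proof.
elim/last_ind: f => [//|f i IH].
by rewrite /occurrences foldl_rcons -/(occurrences f) /unzip1 map_rcons -/(unzip1 _) IH.
Qed.

Lemma occurrences_rcons (I : eqType) (f : seq I) i :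
  occurrences (rcons f i) = rcons (occurrences f) (i, count_mem i f).
Proof.
by rewrite /occurrences foldl_rcons -/(occurrences f) unzip1_occurrences.
Qed.

Lemma size_occurrences (I : eqType) (f : seq I) :
  size (occurrences f) = size f.
Proof. by rewrite -[in RHS](unzip1_occurrences f) size_map. Qed.

Lemma take_occurrences (I : eqType) (f : seq I) k :
  take k (occurrences f) = occurrences (take k f).
Proof.
elim/last_ind: f k => [//|f i IH] k.
have [le_k|lt_k] := leqP k (size f).
  rewrite occurrences_rcons -!cats1 !takel_cat ?size_occurrences //.
rewrite !take_oversize //; first by rewrite size_rcons.
by rewrite size_occurrences size_rcons.
Qed.

Lemma mem_occurrences (I : eqType) (f : seq I) i l :
  ((i, l) \in occurrences f) = (l < count_mem i f)%N.
Proof.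
elim/last_ind: f => [//|f j IH].
rewrite occurrences_rcons mem_rcons inE IH -cats1 count_cat /= addn0 xpair_eqE.
have [->|ne] := eqVneq i j; last by rewrite addn0.
by rewrite /= addn1 ltnS [RHS]leq_eqVlt.
Qed.

Lemma uniq_occurrences (I : eqType) (f : seq I) : uniq (occurrences f).
Proof.
elim/last_ind: f => [//|f j IH].
by rewrite occurrences_rcons rcons_uniq IH mem_occurrences ltnn.
Qed.

Lemma sum_occurrences (V : nmodType) (I : finType) (f : seq I)
    (F : I -> nat -> V) :
  \sum_(q <- occurrences f) F q.1 q.2 =
  \sum_i \sum_(0 <= l < count_mem i f) F i l.
Proof.
elim/last_ind: f => [|f j IH].
  by rewrite big_nil big1 // => i _; rewrite big_geq.
rewrite occurrences_rcons -cats1 big_cat big_seq1 IH /=.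
rewrite (bigD1 j) //= [RHS](bigD1 j) //=.
rewrite -!cats1 !count_cat /= eqxx addn0 addn1 big_nat_recr //=.
rewrite addrAC; congr (_ + _).
apply: eq_bigr => i ne; rewrite count_cat /= eq_sym (negbTE ne) !addn0 //.
Qed.

(** Letters with prescribed multiplicities w can be ordered so that in every
prefix the count of each letter i is within 1 of theta * w i, for a ratio
theta = a / K common to all letters.  Grow the multiplicities as
floor (a * w i / K) for a = 0, ..., K: with K larger than every w i, each step
adds a letter at most once. *)
Lemma balanced_word (I : finType) (w : I -> nat) :
  exists2 f : seq I, (forall i, count_mem i f = w i) &
  forall k, exists a K : nat, [/\ (0 < K)%N, (a <= K)%N & forall i,
    [/\ (count_mem i (take k f) <= w i)%N,
        (a * w i <= K * count_mem i (take k f) + K)%N &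
        (K * count_mem i (take k f) <= a * w i + K)%N]].
Proof.
pose K := (\sum_i w i).+1.
have wK i : (w i <= K)%N by rewrite /K (bigD1 i) //= leqW ?leq_addr.
suff [f fK fP] : exists2 f : seq I, (forall i, count_mem i f = (K * w i) %/ K)%N &
  forall k, exists2 a : nat, (a <= K)%N & forall i,
    [/\ (count_mem i (take k f) <= w i)%N,
        (a * w i <= K * count_mem i (take k f) + K)%N &
        (K * count_mem i (take k f) <= a * w i + K)%N].
  exists f => [i|k]; first by rewrite fK mulKn.
  by have [a aK aP] := fP k; exists a, K.
have: (K <= K)%N by [].
elim: {1 3}K => [_|a IH aK].
  exists [::] => [i|k]; first by rewrite div0n.
  by exists 0%N => // i /=; rewrite muln0 mul0n.
have [f fa fP] := IH (ltnW aK).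
pose g := [seq i <- index_enum I | (a * w i) %/ K != (a.+1 * w i) %/ K]%N.
have stepP i : (a.+1 * w i %/ K =
    (a * w i) %/ K + ((a * w i) %/ K != (a.+1 * w i) %/ K))%N.
  have := wK i; set W := w i => wi.
  have := divn_eq (a * W) K; have := divn_eq (a.+1 * W) K.
  have := ltn_pmod (a * W) (isT : 0 < K)%N; have := ltn_pmod (a.+1 * W) (isT : 0 < K)%N.
  set q := ((a * W) %/ K)%N; set q' := ((a.+1 * W) %/ K)%N.
  move: ((a * W) %% K)%N ((a.+1 * W) %% K)%N => r r'.
  move: q q' => q q' lr' lr; rewrite mulSn => e' e.
  case: eqVneq => [->|ne] /=; rewrite ?addn0 ?addn1 //.
  have : (q <= q')%N by nia.
  have : (q' <= q.+1)%N by nia.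
  by move: ne => /eqP; lia.
have gP i : count_mem i g = ((a * w i) %/ K != (a.+1 * w i) %/ K)%N.
  rewrite /g count_uniq_mem ?filter_uniq ?index_enum_uniq //.
  by rewrite mem_filter mem_index_enum andbT.
exists (f ++ g) => [i|k]; first by rewrite count_cat fa gP -stepP.
have [le_k|lt_k] := leqP k (size f).
  by have [b bK bP] := fP k; exists b => // i; rewrite takel_cat.
exists a => [|i]; first exact: ltnW.
rewrite take_cat ltnNge (ltnW lt_k) /= count_cat fa.
have le1 : (count_mem i (take (k - size f) g) <= count_mem i g)%N.
  rewrite -[X in (_ <= count_mem i X)%N](cat_take_drop (k - size f) g).
  by rewrite count_cat leq_addr.
move: le1; rewrite gP; set c := count_mem _ _ => le1.
have lew : (a.+1 * w i %/ K <= w i)%N.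
  by rewrite -[leqRHS](mulKn _ (isT : 0 < K)%N) leq_div2r // leq_mul2r aK orbT.
rewrite stepP in lew.
have le_cb : (c <= ((a * w i) %/ K != (a.+1 * w i) %/ K))%N by [].
have c1 : (c <= 1)%N by apply: leq_trans le1 (leq_b1 _).
have lt_r := ltn_pmod (a * w i) (isT : 0 < K)%N.
split.
- by apply: leq_trans lew; rewrite leq_add2l.
- rewrite {1}(divn_eq (a * w i) K) mulnDr mulnC -addnA leq_add2l.
  by rewrite (leq_trans (ltnW lt_r)) // leq_addl.
- rewrite mulnDr {2}(divn_eq (a * w i) K) [(_ %/ _ * _)%N]mulnC -addnA leq_add2l.
  by rewrite (@leq_trans K) ?leq_addl // -[leqRHS]muln1 leq_mul2l c1 orbT.
Qed.

(** Only one large p is needed, so p may be taken to be a power 2 ^ r; the claim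
then becomes an inequality between exponents. *)
Lemma exp2_beats_poly (A a : nat) :
  exists2 p, (A <= p)%N & (A * p ^ a <= 2 ^ p)%N.
Proof.
(* The summand 4 is there because r ^ 2 <= 2 ^ r holds from r = 4 on. *)
pose r := (A + a + 4)%N; exists (2 ^ r)%N.
  by apply: (leq_trans _ (ltnW (ltn_expl r _))) => //; rewrite /r; lia.
rewrite -expnM; apply: (@leq_trans (2 ^ A * 2 ^ (r * a))).
  by rewrite leq_mul // ltnW // ltn_expl.
rewrite -expnD leq_exp2l //.
have : (r * r <= 2 ^ r)%N.
  rewrite /r; elim: (A + a)%N => [//|n IH].
  by rewrite addSn expnS; move: IH; set e := (2 ^ _)%N; nia.
by apply: leq_trans; rewrite /r; nia.
Qed.

(** * Estimates near the values 1 / ln X *)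

Lemma dist_exp_le (R : realType) (a b : R) n : 0 <= a <= 1 -> 0 <= b <= 1 ->
  `|a ^+ n - b ^+ n| <= n%:R * `|a - b|.
Proof.
move=> /andP[a0 a1] /andP[b0 b1].
elim: n => [|n IH]; first by rewrite !expr0 subrr normr0 mul0r.
have -> : a ^+ n.+1 - b ^+ n.+1 = a * (a ^+ n - b ^+ n) + (a - b) * b ^+ n.
  by rewrite !exprS; ring.
apply: (le_trans (ler_normD _ _)); rewrite -[in leRHS]natr1 [leRHS]mulrDl mul1r lerD //.
  by rewrite normrM ger0_norm // (le_trans _ IH) // ler_piMl.
by rewrite normrM ler_piMr // ger0_norm ?exprn_ge0 // exprn_ile1.
Qed.

Lemma ln2_ge_half (R : realType) : 2^-1 <= ln (2 : R).
Proof.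
rewrite -ler_expR lnK ?posrE //.
have h : 2^-1 <= expR (- 2^-1) :> R.
  by apply: le_trans (expR_ge1Dx _); lra.
rewrite -[leLHS]invrK -expRN -[leRHS]invrK lef_pV2 // posrE ?invr_gt0 //.
Qed.

(** Beyond X >= e the function 1 / ln has derivative at most 1 / X in absolute
value, and powers of numbers in [0, 1] are Lipschitz. *)
Lemma inv_ln_near (R : realType) (X k n : nat) : 1 <= ln (X%:R : R) ->
  `|(ln (X + k)%:R)^-1 ^+ n - (ln X%:R)^-1 ^+ n| <= n%:R * (k%:R / X%:R) :> R.
Proof.
move=> lnX.
have X0 : 0 < X%:R :> R.
  by rewrite ltNge; apply/negP => /ln0 e; move: lnX; rewrite e ler10.
have lnlt : ln (X%:R : R) <= ln (X + k)%:R.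
  by rewrite ler_ln ?posrE ?natrD ?lerDl // ltr_wpDr.
have ln0' : 0 < ln (X%:R : R) by exact: lt_le_trans lnX.
have inv01 (y : R) : 1 <= y -> 0 <= y^-1 <= 1.
  by move=> y1; rewrite invr_ge0 invf_le1 ?(lt_le_trans ltr01) // y1 (le_trans ler01).
apply: (le_trans (dist_exp_le _ _ _)); [exact/inv01/(le_trans lnX)|exact/inv01|].
rewrite ler_wpM2l //.
set u := ln (X + k)%:R; set v := ln X%:R.
have u0 : 0 < u by exact: lt_le_trans lnlt.
have -> : u^-1 - v^-1 = - ((u - v) / (u * v)).
  by field; rewrite !gt_eqF.
rewrite normrN ger0_norm; last by rewrite divr_ge0 ?subr_ge0 // mulr_ge0 // ltW.
apply: (@le_trans _ _ (u - v)).
  rewrite ler_piMr ?subr_ge0 // invf_le1 ?mulr_gt0 //.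
  by rewrite mulr_ege1 // (le_trans lnX).
rewrite /u /v -ln_div ?posrE //; last by rewrite natrD ltr_wpDr.
rewrite natrD mulrDl divff ?gt_eqF //; apply: le_ln1Dx.
by rewrite (@lt_le_trans _ _ 0) // divr_ge0.
Qed.

(** * Solving for finitely many odd moments *)

(** The matrix of the odd powers r_i^(2m+1) is the Vandermonde matrix of the
r_i^2 times the diagonal matrix of the r_i. *)
Lemma odd_power_basis (R : realType) (d : nat) (r : 'I_d -> R) :
  injective r -> (forall i, 0 < r i) ->
  exists D : 'I_d -> 'I_d -> R, forall m m' : 'I_d,
    \sum_i r i ^+ (2 * m + 1) * D i m' = (m == m')%:R.
Proof.
move=> rI r0.
pose V := Vandermonde d (\row_i (r i ^+ 2)) *m diag_mx (\row_i r i).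
have VE m i : V m i = r i ^+ (2 * m + 1).
  by rewrite /V mul_mx_diag !mxE exprD expr1 exprM.
have Vu : V \in unitmx.
  rewrite unitmx_mul !unitmxE det_Vandermonde det_diag !unitfE.
  apply/andP; split; apply/prodf_neq0 => i _; last by rewrite mxE gt_eqF.
  apply/prodf_neq0 => j lt_ij; rewrite !mxE subr_eq0.
  rewrite eqrXn2 ?ltW //; apply: contraTneq lt_ij => /rI ->.
  by rewrite ltnn.
exists (fun i m' => invmx V i m') => m m'.
have := congr1 (fun A : matrix R d d => A m m') (mulmxV Vu); rewrite !mxE => <-.
by apply: eq_bigr => i _; rewrite VE.
Qed.

(** * The terms near plus or minus 1 / ln (2 ^ (p (i + 1))) *)

(** The shift by 2 is that of the denominators ln (j + 2) of the sequence. *)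
Definition grid (p i k : nat) : nat := (2 ^ (p * i.+1) + k - 2)%N.

(** As 2 ^ (p (i + 1)) is even, the parity of k alone decides the sign. *)
Lemma xseq_grid (R : realType) p i k : (0 < p)%N ->
  xseq R (grid p i k) = (-1) ^+ odd k * (ln (2 ^ (p * i.+1) + k)%:R)^-1.
Proof.
move=> p0; have X2 : (2 ^ 1 <= 2 ^ (p * i.+1))%N by rewrite leq_exp2l // muln_gt0 p0.
rewrite /xseq /grid subnK; last by rewrite (leq_trans X2) // leq_addr.
rewrite -signr_odd oddB; last by rewrite (leq_trans X2) // leq_addr.
by rewrite oddD oddX muln_eq0 /= -leqn0 leqNgt p0 /= addbF.
Qed.

(** The blocks [2 ^ (p (i + 1)), 2 ^ (p (i + 1)) + 2 ^ p) are pairwise disjoint. *)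
Lemma grid_inj p i k i' k' : (0 < p)%N -> (k < 2 ^ p)%N -> (k' < 2 ^ p)%N ->
  grid p i k = grid p i' k' -> i = i' /\ k = k'.
Proof.
move=> p0; wlog le_ii : i i' k k' / (i <= i')%N.
  move=> wl hk hk' e; have [/wl|/ltnW/wl] := leqP i i'; first exact.
  by move=> /(_ k' k hk' hk (esym e))[-> ->].
have X2 j : (2 ^ p <= 2 ^ (p * j.+1))%N by rewrite leq_exp2l // leq_pmulr.
have p2 : (2 ^ 1 <= 2 ^ p)%N by rewrite leq_exp2l.
rewrite /grid => hk hk' e.
have {}e : (2 ^ (p * i.+1) + k = 2 ^ (p * i'.+1) + k')%N.
  by move: (X2 i) (X2 i') p2 e; lia.
have [eii|ne] := eqVneq i i'; first by subst i'; split=> //; lia.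
have lt_ii : (i < i')%N by rewrite ltn_neqAle ne.
have : (2 ^ (p * i.+1) * 2 <= 2 ^ (p * i'.+1))%N.
  by rewrite -expnSr leq_exp2l //; nia.
by move: (X2 i); lia.
Qed.

(** * Steering finitely many moments along a segment *)

Definition odd_moment (R : realType) (m : nat) (s : seq nat) : R :=
  \sum_(j <- s) xseq R j ^+ (2 * m + 1).

(** The total y may be any real number close to the number n of terms: the first
part of the bound is the cost of replacing each term by 1 / ln X, the second that
of replacing n by y. *)
Lemma cluster_sum (R : realType) (X n M : nat) (b : bool) (y : R) :
  1 <= ln (X%:R : R) -> (0 < M)%N -> `|n%:R - y| <= 2 ->
  `|\sum_(0 <= l < n) (ln (X + (2 * l + b))%:R)^-1 ^+ M
      - y * (ln (X%:R : R))^-1 ^+ M|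
    <= (n * M * (2 * n))%:R / X%:R + 2 / ln X%:R.
Proof.
move=> lnX M0 ny.
have ln0' : 0 < ln (X%:R : R) by exact: lt_le_trans lnX.
have t0 : 0 <= (ln (X%:R : R))^-1 by rewrite invr_ge0 ltW.
have t1 : (ln (X%:R : R))^-1 <= 1 by rewrite invf_le1.
set t := (ln (X%:R : R))^-1 in t0 t1 *.
have -> : \sum_(0 <= l < n) (ln (X + (2 * l + b))%:R)^-1 ^+ M - y * t ^+ M =
  \sum_(0 <= l < n) ((ln (X + (2 * l + b))%:R)^-1 ^+ M - t ^+ M)
    + (n%:R - y) * t ^+ M.
  by rewrite sumrB sumr_const_nat subn0 -mulr_natl; ring.
apply: (le_trans (ler_normD _ _)); apply: lerD; last first.
  rewrite normrM ler_pM // ger0_norm ?exprn_ge0 //.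
  by rewrite -(prednK M0) exprS ler_piMr // exprn_ile1.
apply: (le_trans (ler_norm_sum _ _ _)).
have -> : (n * M * (2 * n))%:R / X%:R =
    \sum_(0 <= l < n) (M%:R * ((2 * n)%:R / X%:R)) :> R.
  by rewrite sumr_const_nat subn0 -mulr_natl !natrM; ring.
apply: ler_sum_nat => l /andP[_ ln]; apply: (le_trans (inv_ln_near _ _ _)) => //.
rewrite ler_wpM2l // ler_wpM2r // ler_nat.
by case: b; lia.
Qed.

(** Offsets 2 * l + b have a constant parity b, hence give terms of one sign; this
sign survives odd powers and can be pulled out of the sum. *)
Lemma odd_moment_place (R : realType) (d p m : nat) (b : 'I_d -> bool)
    (f : seq 'I_d) : (0 < p)%N ->
  odd_moment R m [seq grid p q.1 (2 * q.2 + b q.1) | q : 'I_d * nat <- occurrences f] =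
  \sum_i (-1) ^+ b i * \sum_(0 <= l < count_mem i f)
     (ln (2 ^ (p * i.+1) + (2 * l + b i))%:R)^-1 ^+ (2 * m + 1).
Proof.
move=> p0; rewrite /odd_moment big_map.
rewrite (sum_occurrences f
  (fun i l => xseq R (grid p i (2 * l + b i)) ^+ (2 * m + 1))).
apply: eq_bigr => i _; rewrite mulr_sumr; apply: eq_bigr => l _.
rewrite xseq_grid // oddD oddM /= oddb exprMn; congr (_ * _).
by case: (b i); rewrite ?expr1n //= expr1 -signr_odd oddD oddM.
Qed.

(** The points are t_i = r_i / p with r_i = 1 / ((i + 1) ln 2) fixed.  Expressing v
by the vectors gamma (t_i) amounts to expressing the vector of the p^(2m+1) v_m by
the vectors gamma (r_i), so the coefficients c_i are O (p^(2d)).  Each letter i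
then costs an error of order p^(4d) / 2^p for approximating t_i, and of order
t_i = O (1/p) for the rounding of counts.  The p given by [exp2_beats_poly] makes
these errors at most 1 / p and 4 / p per letter, and 5 d / p <= eps. *)
Lemma steering (R : realType) (d N : nat) (v : nat -> R) (eps : R) : 0 < eps ->
  exists s : seq nat, [/\ uniq s, {in s, forall j, (N <= j)%N},
    forall m, (m < d)%N -> `|odd_moment R m s - v m| <= eps &
    forall k, exists2 theta : R, 0 <= theta <= 1 & forall m, (m < d)%N ->
      `|odd_moment R m (take k s) - theta * v m| <= eps].
Proof.
move=> eps0.
have ln2 := ln2_ge_half R; have ln20 : 0 < ln (2 : R) by apply: lt_le_trans ln2.
pose r (i : 'I_d) : R := (i.+1%:R * ln 2)^-1.
have r0 i : 0 < r i by rewrite invr_gt0 mulr_gt0.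
have rI : injective r.
  move=> i j /invr_inj /mulIf e; apply: val_inj; apply: succn_inj.
  by apply/eqP; rewrite -(eqr_nat R); apply/eqP/e; rewrite gt_eqF.
have [D DP] := odd_power_basis rI r0.
pose C := (Num.trunc (\sum_i \sum_(m < d) `|v m * D i m|)).+1.
have CP i : \sum_(m < d) `|v m * D i m| <= C%:R.
  apply: (@le_trans _ _ (\sum_i \sum_(m < d) `|v m * D i m|)).
    rewrite [leRHS](bigD1 i) //= lerDl.
    by apply: sumr_ge0 => j _; apply: sumr_ge0.
  by apply/ltW/truncnS_gt.
pose B := (Num.trunc (5 * d%:R / eps)).+1.
have BP : 5 * d%:R <= eps * B%:R.
  by rewrite -ler_pdivrMl // mulrC; apply/ltW/truncnS_gt.
have [p Ap p_exp] := exp2_beats_poly (N + 2 + B + 4 * d * C ^ 2 + 2 * C) (4 * d + 1).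
have p0 : (0 < p)%N by lia.
pose c (i : 'I_d) : R := \sum_(m < d) p%:R ^+ (2 * m + 1) * (v m * D i m).
have cE m : (m < d)%N -> \sum_i c i * (r i / p%:R) ^+ (2 * m + 1) = v m.
  move=> md; under eq_bigr do rewrite mulr_suml.
  (* Duality of D and r leaves only the m-th coordinate of v. *)
  rewrite exchange_big /= (bigD1 (Ordinal md)) //= [X in _ + X]big1 ?addr0.
    have := DP (Ordinal md) (Ordinal md); rewrite eqxx => DP1.
    rewrite -[RHS]mulr1 -[X in _ = _ * X]DP1 mulr_sumr; apply: eq_bigr => i _ /=.
    by rewrite expr_div_n; field; rewrite expf_neq0 // pnatr_eq0 -lt0n.
  move=> m' ne; transitivity (p%:R ^+ (2 * m' + 1) * v m' / p%:R ^+ (2 * m + 1) *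
     \sum_i r i ^+ (2 * m + 1) * D i m').
    by rewrite mulr_sumr; apply: eq_bigr => i _; rewrite expr_div_n; ring.
  by have := DP (Ordinal md) m'; rewrite /= => ->; rewrite eq_sym (negbTE ne) mulr0.
have cC i : `|c i| <= (C * p ^ (2 * d))%:R.
  apply: (le_trans (ler_norm_sum _ _ _)).
  apply: (@le_trans _ _ ((\sum_(m < d) `|v m * D i m|) * (p ^ (2 * d))%:R)).
    rewrite mulr_suml; apply: ler_sum => m _; rewrite normrM mulrC ler_wpM2l //.
    rewrite normrX normr_nat -natrX ler_nat leq_exp2l; first by have := ltn_ord m; lia.
    by lia.
  by rewrite natrM ler_wpM2r.
pose b i := c i < 0; pose w i := Num.trunc `|c i|.
have wc i : (w i)%:R <= `|c i| < (w i).+1%:R by rewrite truncn_itv.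
have wC i : (w i <= C * p ^ (2 * d))%N.
  by rewrite -(ler_nat R); apply: le_trans (cC i); case/andP: (wc i).
pose place (q : 'I_d * nat) := grid p q.1 (2 * q.2 + b q.1).
(* The tolerance 2 is 1 for the interleaving plus 1 for the rounding of the
   real number |c_i| to the multiplicity w i. *)
have est (f : seq 'I_d) (theta : R) : 0 <= theta <= 1 ->
    (forall i, (count_mem i f <= w i)%N) ->
    (forall i, `|(count_mem i f)%:R - theta * `|c i| | <= 2) ->
    forall m, (m < d)%N ->
    `|odd_moment R m (map place (occurrences f)) - theta * v m| <= eps.
  move=> th01 fw fth m md; rewrite odd_moment_place // -(cE m md) mulr_sumr -sumrB.
  apply: (le_trans (ler_norm_sum _ _ _)).
  apply: (@le_trans _ _ (\sum_(i < d) (5 / p%:R))); last first.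
    rewrite sumr_const card_ord -[_ *+ d]mulr_natl mulrA ler_pdivrMr ?ltr0n // mulrC.
    apply: (le_trans BP); rewrite ler_wpM2l ?ler_nat //; [exact: ltW|lia].
  apply: ler_sum => i _.
  set X := (2 ^ (p * i.+1))%N.
  have lnXE : ln (X%:R : R) = p%:R * (i.+1%:R * ln 2).
    by rewrite /X natrX lnXn // -[_ *+ (p * _)]mulr_natl natrM mulrA.
  have rE : r i / p%:R = (ln X%:R)^-1 by rewrite lnXE invfM mulrC.
  have lnXp : p%:R / 2 <= ln (X%:R : R).
    rewrite lnXE ler_wpM2l //; apply: (le_trans ln2).
    by rewrite ler_peMl ?ler1n // ltW.
  have lnX1 : 1 <= ln (X%:R : R).
    apply: le_trans lnXp; rewrite ler_pdivlMr // mul1r ler_nat; lia.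
  rewrite rE {1}[c i]numEsign -/(b i).
  have -> : theta * ((-1) ^+ b i * `|c i| * (ln X%:R)^-1 ^+ (2 * m + 1)) =
    (-1) ^+ b i * ((theta * `|c i|) * (ln X%:R)^-1 ^+ (2 * m + 1)) by ring.
  rewrite -mulrBr normrM normrX normrN1 expr1n mul1r.
  apply: (le_trans (cluster_sum _ _ _ (fth i))) => //; first by rewrite addn1.
  have -> : 5 / p%:R = p%:R^-1 + 4 / p%:R :> R by ring.
  apply: lerD; last first.
    rewrite ler_pdivrMr ?(lt_le_trans ltr01) // mulrAC ler_pdivlMr ?ltr0n //.
    by move: lnXp; lra.
  rewrite ler_pdivrMr ?ltr0n ?expn_gt0 // mulrC ler_pdivlMr ?ltr0n // -natrM ler_nat.
  apply: (@leq_trans (2 ^ p)); last by rewrite leq_exp2l // leq_pmulr.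
  apply: leq_trans p_exp; set n := count_mem i f.
  have nC : (n <= C * p ^ (2 * d))%N by apply: leq_trans (fw i) (wC i).
  have -> : (p ^ (4 * d + 1) = p ^ (2 * d) * p ^ (2 * d) * p)%N.
    by rewrite -expnD -expnSr; congr (_ ^ _)%N; lia.
  apply: (@leq_trans (4 * d * C ^ 2 * (p ^ (2 * d) * p ^ (2 * d) * p))%N); last first.
    by rewrite leq_mul2r; apply/orP; right; lia.
  rewrite !mulnA leq_mul2r; apply/orP; right.
  apply: (@leq_trans (n * n * (4 * d))).
    by rewrite -mulnA [leqRHS]mulnAC -!mulnA leq_mul2l; nia.
  apply: (@leq_trans (C * p ^ (2 * d) * (C * p ^ (2 * d)) * (4 * d))).
    by rewrite leq_mul2r leq_mul ?orbT.
  by apply: eq_leq; ring.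
have [f fw fP] := balanced_word w.
exists (map place (occurrences f)); split.
- rewrite map_inj_in_uniq ?uniq_occurrences // => -[i l] [i' l'].
  rewrite !mem_occurrences !fw /place /= => li li' e.
  have small j k : (k < w j)%N -> (2 * k + b j < 2 ^ p)%N.
    move=> kw; apply: (@leq_trans (2 * (C * p ^ (2 * d)))).
      by have := wC j; case: (b j); lia.
    apply: leq_trans p_exp; rewrite mulnA leq_mul //; first by lia.
    by rewrite leq_exp2l; lia.
  have [/val_inj ei ek] := grid_inj p0 (small _ _ li) (small _ _ li') e.
  by subst i'; congr (_, _); lia.
- move=> j /mapP[[i l] _ ->]; rewrite /place /grid /=.
  apply: (@leq_trans (2 ^ p - 2)).
    by have := ltn_expl p (isT : 1 < 2)%N; lia.
  by rewrite leq_sub2r // (leq_trans _ (leq_addr _ _)) // leq_exp2l // leq_pmulr.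
- move=> m md; rewrite -[v m]mul1r; apply: est => //.
  + by rewrite ler01 lexx.
  + by move=> i; rewrite fw.
  + move=> i; rewrite fw mul1r; case/andP: (wc i) => h1 h2.
    by rewrite distrC ger0_norm ?subr_ge0 //; move: h2; rewrite -natr1; lra.
- move=> k; have [a [K [K0 aK kP]]] := fP k.
  have K0R : 0 < K%:R :> R by rewrite ltr0n.
  exists (a%:R / K%:R) => [|m md].
    by rewrite divr_ge0 //= ler_pdivrMr // mul1r ler_nat.
  rewrite -map_take take_occurrences; apply: est => //.
  + by rewrite divr_ge0 //= ler_pdivrMr // mul1r ler_nat.
  + by move=> i; have [] := kP i.
  + move=> i; have [_] := kP i; set n := count_mem i _ => le1 le2.
    case/andP: (wc i) => h1 h2.
    have th0 : 0 <= a%:R / K%:R :> R by rewrite divr_ge0.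
    have th1 : a%:R / K%:R <= 1 :> R by rewrite ler_pdivrMr // mul1r ler_nat.
    have : `|n%:R - a%:R / K%:R * (w i)%:R| <= 1 :> R.
      rewrite -(ler_pM2r K0R) mul1r -[X in _ * X <= _](ger0_norm (ltW K0R)) -normrM.
      have -> : (n%:R - a%:R / K%:R * (w i)%:R) * K%:R = (K * n)%:R - (a * w i)%:R :> R.
        by rewrite !natrM; field; rewrite gt_eqF.
      by rewrite ler_distl lerBlDr -!natrD !ler_nat le1 le2.
    have : `|a%:R / K%:R * (w i)%:R - a%:R / K%:R * `|c i| | <= 1.
      rewrite -mulrBr normrM ger0_norm // mulr_ile1 //.
      by rewrite distrC ger0_norm ?subr_ge0 //; move: h2; rewrite -natr1; lra.
    by rewrite !ler_norml => /andP[? ?] /andP[? ?]; apply/andP; split; lra.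
Qed.

(** * Assembling the stages *)

(** Position j is already settled in the list S j.+1, which has more than j
entries as it contains 0, ..., j without repetition; likewise index i occurs in
S i.+1, at a position that later lists do not change. *)
Lemma exhaustion_bijection (S : nat -> seq nat) :
  (forall n, uniq (S n)) -> (forall n, prefix (S n) (S n.+1)) ->
  (forall n, n \in S n.+1) ->
  exists2 sigma : nat -> nat, bijective sigma &
    forall n, S n = mkseq sigma (size (S n)) /\ (n <= size (S n))%N.
Proof.
move=> Su Sp Sn.
have Sle n n' : (n <= n')%N -> prefix (S n) (S n').
  elim: n' => [|n' IH]; first by rewrite leqn0 => /eqP ->; exact: prefix_refl.
  rewrite leq_eqVlt => /orP[/eqP ->|/IH h]; first exact: prefix_refl.
  exact: prefix_trans h (Sp _).
have Ssz n : (n <= size (S n))%N.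
  rewrite -{1}(size_iota 0 n); apply: uniq_leq_size; first exact: iota_uniq.
  move=> i; rewrite mem_iota add0n /= => /Sle /prefixP[t ->].
  by rewrite mem_cat Sn.
have nthE n n' j : (j < size (S n))%N -> (j < size (S n'))%N ->
    nth 0%N (S n) j = nth 0%N (S n') j.
  wlog le : n n' / (n <= n')%N.
    by move=> wl; have [/wl|/ltnW/wl h] := leqP n n'; [exact|move=> *; rewrite h].
  by move: (Sle _ _ le) => /prefixP[t ->] h _; rewrite nth_cat h.
have idxE n n' i : i \in S n -> i \in S n' -> index i (S n) = index i (S n').
  wlog le : n n' / (n <= n')%N.
    by move=> wl; have [/wl|/ltnW/wl h] := leqP n n'; [exact|move=> *; rewrite h].
  by move: (Sle _ _ le) => /prefixP[t ->] h _; rewrite index_cat h.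
pose sigma j := nth 0%N (S j.+1) j; exists sigma.
  exists (fun i => index i (S i.+1)) => [j|i].
    rewrite (idxE _ j.+1) ?Sn //; last by rewrite mem_nth.
    by rewrite index_uniq.
  rewrite /sigma (nthE _ i.+1) ?nth_index ?index_mem //; exact: Ssz.
move=> n; split=> //.
apply: (@eq_from_nth _ 0%N) => [|j hj]; first by rewrite size_mkseq.
by rewrite nth_mkseq // /sigma; apply: nthE => //; exact: leq_trans (Ssz _).
Qed.

Lemma between_stages (a : nat -> nat) (n0 J : nat) : (forall n, n <= a n)%N ->
  (a n0 <= J)%N -> exists2 n, (n0 <= n)%N & (a n <= J <= a n.+1)%N.
Proof.
move=> an h0.
have [k] : exists k, (J < a (n0 + k))%N.
  by exists J.+1; apply: leq_trans (an _); rewrite leq_addl.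
elim: k => [|k IH]; first by rewrite addn0 ltnNge h0.
have [/IH //|Jk lt_J] := ltnP J (a (n0 + k)%N).
by exists (n0 + k)%N; rewrite ?leq_addr // Jk -addnS ltnW.
Qed.

Lemma odd_moment_cat (R : realType) m (s t : seq nat) :
  odd_moment R m (s ++ t) = odd_moment R m s + odd_moment R m t.
Proof. exact: big_cat. Qed.

(** After n has been appended (if missing), the remaining discrepancy v is removed
by steering.  While the steering is at theta * v, the distance to the target is
(1 - theta) |v| up to 1/(n+1), hence never exceeds |v| by more than that. *)
Lemma next_stage (R : realType) (mu : nat -> R) (n : nat) (s : seq nat) :
  uniq s -> exists s' : seq nat, [/\ uniq s', prefix s s', n \in s',
    forall m, (m <= n)%N -> `|odd_moment R m s' - mu m| <= n.+1%:R^-1 &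
    forall m k, (m <= n)%N -> (size s <= k)%N ->
      `|odd_moment R m (take k s') - mu m| <=
        `|odd_moment R m s - mu m| + `|xseq R n| ^+ (2 * m + 1) + n.+1%:R^-1].
Proof.
move=> us; pose s1 := if n \in s then s else rcons s n.
have us1 : uniq s1.
  by rewrite /s1; case: ifP => [//|ns]; rewrite rcons_uniq ns us.
have ns1 : n \in s1 by rewrite /s1; case: ifP => // _; rewrite mem_rcons inE eqxx.
have s_s1 : prefix s s1.
  by rewrite /s1; case: ifP => _; [exact: prefix_refl|exact: prefix_rcons].
have s1m m : `|odd_moment R m s1 - mu m| <=
    `|odd_moment R m s - mu m| + `|xseq R n| ^+ (2 * m + 1).
  rewrite /s1; case: ifP => _; first by rewrite lerDl exprn_ge0.
  rewrite -cats1 odd_moment_cat {2}/odd_moment big_seq1 addrAC -normrX.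
  exact: ler_normD.
have inv0 : 0 < n.+1%:R^-1 :> R by rewrite invr_gt0.
have [t [ut tN tE tk]] := steering n.+1 (\max_(j <- s1) j).+1
  (fun m => mu m - odd_moment R m s1) inv0.
exists (s1 ++ t); split.
- rewrite cat_uniq us1 ut andbT -all_predC; apply/allP => j /tN /= jN.
  apply/negP => js1; move: jN; rewrite ltnNge => /negP; apply.
  exact: leq_bigmax_seq.
- exact: prefix_trans s_s1 (prefix_prefix _ _).
- by rewrite mem_cat ns1.
- move=> m mn; have := tE m mn; rewrite odd_moment_cat opprB addrA.
  by rewrite [_ + odd_moment R m s1]addrC.
- move=> m k mn sk.
  have [ks1|s1k] := ltnP k (size s1).
    have [ks s1E] : k = size s /\ s1 = rcons s n.
      move: ks1; rewrite /s1; case: ifP => _; first by rewrite ltnNge sk.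
      by rewrite size_rcons ltnS => h; split=> //; apply/eqP; rewrite eqn_leq h.
    rewrite s1E -cats1 -catA ks take_size_cat //.
    by rewrite -addrA lerDl addr_ge0 ?exprn_ge0 // ltW.
  rewrite take_cat ltnNge s1k /= odd_moment_cat.
  have [th /andP[th0 th1] thE] := tk (k - size s1)%N.
  have {thE} := thE m mn; set M := odd_moment R m (take _ _) => hM.
  have := s1m m; set E := _ + _ ^+ _ => hE.
  have -> : odd_moment R m s1 + M - mu m =
     (1 - th) * (odd_moment R m s1 - mu m) + (M - th * (mu m - odd_moment R m s1)).
    by ring.
  apply: (le_trans (ler_normD _ _)); apply: lerD => //.
  rewrite normrM (le_trans _ hE) // ler_piMl // ger0_norm; lra.
Qed.

Lemma xseq_norm_le (R : realType) (e : R) : 0 < e ->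
  exists N : nat, forall n, (N <= n)%N -> `|xseq R n| <= e.
Proof.
move=> e0; exists (Num.trunc (expR e^-1)).+1 => n le_n.
have h : expR e^-1 <= (n + 2)%:R.
  apply: (le_trans (ltW (truncnS_gt _))); rewrite ler_nat.
  by apply: (leq_trans le_n); rewrite leq_addr.
have {}h : e^-1 <= ln (n + 2)%:R.
  by rewrite -ler_expR lnK // posrE (lt_le_trans _ h) // expR_gt0.
have ei : 0 < e^-1 by rewrite invr_gt0.
have l0 : 0 < ln (n + 2)%:R :> R by exact: lt_le_trans h.
rewrite /xseq normrM normrX normrN1 expr1n mul1r normfV gtr0_norm //.
by rewrite -[leRHS]invrK lef_pV2.
Qed.

Lemma stages_exist (R : realType) (mu : nat -> R) :
  exists S : nat -> seq nat, forall n,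
    [/\ uniq (S n), prefix (S n) (S n.+1), n \in S n.+1,
      forall m, (m <= n)%N -> `|odd_moment R m (S n.+1) - mu m| <= n.+1%:R^-1 &
      forall m k, (m <= n)%N -> (size (S n) <= k)%N ->
        `|odd_moment R m (take k (S n.+1)) - mu m| <=
          `|odd_moment R m (S n) - mu m| + `|xseq R n| ^+ (2 * m + 1)
            + n.+1%:R^-1].
Proof.
have /choice[next nextP] : forall q : nat * seq nat, exists s' : seq nat,
    uniq q.2 -> [/\ uniq s', prefix q.2 s', q.1 \in s',
    forall m, (m <= q.1)%N -> `|odd_moment R m s' - mu m| <= q.1.+1%:R^-1 &
    forall m k, (m <= q.1)%N -> (size q.2 <= k)%N ->
      `|odd_moment R m (take k s') - mu m| <= `|odd_moment R m q.2 - mu m|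
        + `|xseq R q.1| ^+ (2 * m + 1) + q.1.+1%:R^-1].
  move=> [n s] /=; have [us|_] := boolP (uniq s); last by exists [::].
  by have [s' sP] := next_stage mu n us; exists s'.
pose S := fix S n := if n is k.+1 then next (k, S k) else [::].
have Su n : uniq (S n) by elim: n => [//|n /(nextP (n, S n))[]].
exists S => n; have [_ ? ? ? ?] := nextP (n, S n) (Su n).
by split=> //.
Qed.

(** From stage n0 on, the three contributions to the distance to mu m, namely the
distance at the start of the stage, the inserted term and the steering error, are
at most e / 3 each. *)
Lemma xseq_moment_rearrangement (R : realType) (mu : nat -> R) :
  exists u : nat -> R, rearrangement (@xseq R) u /\
    forall m : nat, series (fun j => u j ^+ (2 * m + 1)) @ \oo --> mu m.
Proof.
have [S SP] := stages_exist mu.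
have [sigma sbij sE] : exists2 sigma : nat -> nat, bijective sigma &
    forall n, S n = mkseq sigma (size (S n)) /\ (n <= size (S n))%N.
  by apply: exhaustion_bijection => n; case: (SP n).
exists (fun j => xseq R (sigma j)); split; first by exists sigma.
move=> m; apply/cvgrPdist_le => e e0.
(* The cap 1 makes |x_n|^(2m+1) <= |x_n| for late n. *)
pose e3 := Num.min (e / 3) 1.
have e30 : 0 < e3 by rewrite lt_min divr_gt0 //= ltr01.
have [N0 N0P] := xseq_norm_le e30.
pose n0 := (N0 + m + Num.trunc e3^-1).+1.
exists (size (S n0)) => // J /= le_J.
have [n le_n /andP[le1 le2]] :=
  between_stages (fun n => (sE n).2) le_J.
have -> : series (fun j => xseq R (sigma j) ^+ (2 * m + 1)) J =
    odd_moment R m (take J (S n.+1)).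
  rewrite (sE n.+1).1 /mkseq -map_take take_iota (minn_idPl le2).
  by rewrite /odd_moment big_map seriesEnat /= /index_iota subn0.
have inv_e3 k : (n0 <= k)%N -> k%:R^-1 <= e3.
  move=> le_k; rewrite -[leRHS]invrK lef_pV2 ?posrE ?invr_gt0 ?ltr0n //;
    last by rewrite (leq_trans _ le_k).
  apply: (le_trans (ltW (truncnS_gt _))); rewrite ler_nat.
  by apply: leq_trans le_k; rewrite /n0 ltnS leq_addl.
have mn : (m <= n)%N by apply: leq_trans le_n; rewrite /n0; lia.
have b1 : `|odd_moment R m (S n) - mu m| <= e3.
  have n0n : n = n.-1.+1 by move: le_n; rewrite /n0; lia.
  have [_ _ _ h _] := SP n.-1; rewrite n0n; apply: le_trans (h m _) _.
    by move: le_n; rewrite /n0 /=; lia.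
  by apply: inv_e3; rewrite /= -n0n.
have b2 : `|xseq R n| ^+ (2 * m + 1) <= e3.
  have h : `|xseq R n| <= e3 by apply: N0P; apply: leq_trans le_n; rewrite /n0; lia.
  rewrite addn1 exprS; apply: le_trans h.
  rewrite ler_piMr // exprn_ile1 //.
  apply: le_trans (N0P n _) _; rewrite ?ge_min ?lexx ?orbT //.
  by move: le_n; rewrite /n0; lia.
rewrite distrC.
have [_ _ _ _ h] := SP n; apply: le_trans (h m J mn le1) _.
have b3 : n.+1%:R^-1 <= e3 by apply: inv_e3; rewrite leqW.
apply: le_trans (lerD (lerD b1 b2) b3) _.
have : e3 <= e / 3 by rewrite ge_min lexx.
lra.
Qed.

(** * The sequence is not symmetrical *)

(** The absolute values 1 / ln (k + 2) are pairwise distinct, so only k = 0 could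
give the value - x_0, and x_0 is positive. *)
Lemma xseq_neq_opp0 (R : realType) k : xseq R k != - xseq R 0%N.
Proof.
have l2 : 0 < ln (2 : R) by apply: lt_le_trans (ln2_ge_half R); rewrite invr_gt0.
apply/eqP => /[dup] xE /(congr1 Num.norm).
rewrite normrN /xseq !normrM !normrX !normrN1 !expr1n !mul1r !normfV.
rewrite !ger0_norm ?ln_ge0 ?ler1n ?addn2 // => /invr_inj /ln_inj.
rewrite !posrE !ltr0n => /(_ isT isT) /eqP; rewrite eqr_nat => /eqP[k0].
have x0 : 0 < xseq R 0 by rewrite /xseq expr0 mul1r add0n invr_gt0.
by move: xE; rewrite k0; lra.
Qed.

Theorem proposition5p6 (R : realType) :
  (forall mu : nat -> R, exists u : nat -> R,
     rearrangement (@xseq R) u /\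
     forall m : nat, series (fun j => u j ^+ (2 * m + 1)) @ \oo --> mu m) /\
  (exists u : nat -> R,
     (forall m : nat, series (fun j => u j ^+ (2 * m + 1)) @ \oo --> (0 : R)) /\
     ~ exists z : nat -> R[i],
         symmetrical2 z /\ rearrangement z (fun j => (u j)%:C)).
Proof.
split; first exact: xseq_moment_rearrangement.
have [u [[sigma [sigma' _ sigmaK] uE] uP]] := xseq_moment_rearrangement (fun=> 0 : R).
exists u; split=> // -[z [zsym [tau [tau' _ tauK] uz]]].
have zE j : z j = (u (tau' j))%:C by rewrite uz tauK.
(* Symmetry of z would make - x_0 a value of z, hence a term of the sequence. *)
have /card_set_bijP[f [fA _ _]] := zsym (xseq R 0)%:C.
have /fA /= : [set j | z j = (xseq R 0)%:C] (tau (sigma' 0%N)).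
  by rewrite /= -uz uE sigmaK.
rewrite zE uE => /(congr1 (fun c => - c)); rewrite opprK.
move=> /(congr1 (@complex.Re R)) /=.
by apply/eqP; apply: xseq_neq_opp0.
Qed.
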